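(* Let $M$ be a binary matroid on a finite ground set $E$, let $A\subseteq E$, and let $D=M*A$. If the delta-matroid $D$ is bipartite, then its dual $D^{*}$ is Eulerian.
   Context: A set system is a pair $D=(E,\mathcal{F})$ with $E$ a finite set and $\mathcal{F}$ a collection of subsets of $E$ (the feasible sets); it is proper if $\mathcal{F}\neq\emptyset$. A delta-matroid is a proper set system satisfying the symmetric exchange axiom: for all $X,Y\in\mathcal{F}$ and $u\in X\Delta Y$ there is $v\in X\Delta Y$ (possibly $v=u$) such that $X\Delta\{u,v\}\in\mathcal{F}$, where $\Delta$ is symmetric difference. A matroid is regarded as a delta-matroid whose feasible sets are its bases. For $A\subseteq E$, the twist of $D=(E,\mathcal{F})$ is $D*A=(E,\{A\Delta X: X\in\mathcal{F}\})$ (for a matroid $M$, $\mathcal{F}$ is its set of bases). A twist of a delta-matroid is a delta-matroid. The dual of $D$ is $D^{*}=D*E$. A binary matroid is one representable over $GF(2)$. $D_{min}=(E,\mathcal{F}_{min})$, where $\mathcal{F}_{min}$ is the set of feasible sets of minimum cardinality. It is a matroid whose set of bases is $\mathcal{F}_{min}$ (the lower matroid of $D$). A matroid is bipartite if every circuit has even cardinality. A matroid $N$ is Eulerian if there are pairwise disjoint circuits $C_1,\dots,C_p$ of $N$ with $E(N)=C_1\cup\cdots\cup C_p$ (with $p=0$ allowed, so the matroid on the empty ground set is Eulerian). A delta-matroid $D$ is bipartite (respectively Eulerian) if the matroid $D_{min}$ is bipartite (respectively Eulerian). *)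

(* Defs.v *)
From mathcomp Require Import all_boot all_algebra.

Set Implicit Arguments.
Unset Strict Implicit.
Unset Printing Implicit Defensive.

(* The ground set is the whole finite type E (possibly empty), so a set system
   on E is given by its collection of feasible sets.  A matroid is given by its
   collection of bases, which makes it a set system. *)
Notation set_system E := {set {set E}}.

Section SetSystems.

Variable E : finType.
Implicit Types (D M N : set_system E) (A B C X Y : {set E}).

Definition symdiff X Y : {set E} := (X :\: Y) :|: (Y :\: X).

Definition is_delta_matroid D : Prop :=
  D != set0 /\
  forall X Y, X \in D -> Y \in D -> forall u, u \in symdiff X Y ->
  exists2 v, v \in symdiff X Y & symdiff X [set u; v] \in D.

Definition is_matroid M : Prop :=
  M != set0 /\
  forall B1 B2, B1 \in M -> B2 \in M -> forall x, x \in B1 :\: B2 ->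
  exists2 y, y \in B2 :\: B1 & y |: (B1 :\ x) \in M.

Definition twist D A : set_system E := [set symdiff A X | X in D].

Definition dual D : set_system E := twist D [set: E].

(* D_min *)
Definition lower D : set_system E :=
  [set X in D | [forall Y in D, #|X| <= #|Y|]].

Definition indep M X : bool := [exists B in M, X \subset B].

Definition circuit M C : bool := minset (fun X => ~~ indep M X) C.

(* [free] is tested on the family (v e)_(e in X), so parallel elements, which
   are mapped to equal vectors, are dependent. *)
Definition representable (F : fieldType) M : Prop :=
  exists (m : nat) (v : E -> 'cV[F]_m),
  forall X, indep M X = free [seq v e | e <- enum X].

Definition is_binary_matroid M : Prop :=
  is_matroid M /\ representable 'F_2 M.

Definition bipartite_matroid N : Prop :=
  forall C, circuit N C -> ~~ odd #|C|.

Definition eulerian_matroid N : Prop :=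
  exists P : {set {set E}},
  [/\ forall C, C \in P -> circuit N C, trivIset P & cover P = [set: E]].

Definition bipartite D : Prop := bipartite_matroid (lower D).

Definition eulerian D : Prop := eulerian_matroid (lower D).

Lemma in_symdiff X Y u : (u \in symdiff X Y) = (u \in X) (+) (u \in Y).
Proof. by rewrite !inE; case: (u \in X); case: (u \in Y). Qed.

Lemma symdiff_swap B x y :
  x \in B -> y \notin B -> symdiff B [set x; y] = y |: (B :\ x).
Proof.
move=> xB yB; apply/setP=> z; rewrite in_symdiff !inE.
case: (eqVneq z x) => [->|_] /=; first by rewrite xB; case: eqP yB => // <-; rewrite xB.
by case: (eqVneq z y) => [->|_] /=; rewrite ?(negPf yB) ?addbF.
Qed.

Lemma matroid_card M B1 B2 :
  is_matroid M -> B1 \in M -> B2 \in M -> #|B1| = #|B2|.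
Proof.
move=> [_ exM].
suff le B B' : B \in M -> B' \in M -> #|B| <= #|B'|.
  by move=> M1 M2; apply/eqP; rewrite eqn_leq !le.
move: {2}#|_|.+1 (ltnSn #|B :\: B'|) => n.
elim: n B => // n IH B; rewrite ltnS => ltn BM B'M.
have [sBB'|/subsetPn[x xB xB']] := boolP (B \subset B').
  exact: subset_leq_card.
have [|y] := exM _ _ BM B'M x; first by rewrite inE xB xB'.
rewrite inE => /andP[yB yB'] M'.
have -> : #|B| = #|y |: (B :\ x)|.
  by rewrite cardsU1 !inE (negPf yB) andbF (cardsD1 x B) xB.
apply: IH => //; apply: leq_trans ltn; apply: proper_card.
apply/properP; split.
  by apply/subsetP=> z; rewrite !inE => /andP[zB'] /orP[/eqP zy|/andP[_ ->]];
    rewrite ?zB' //; rewrite zy yB' in zB'.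
exists x; rewrite !inE ?xB ?xB' // eqxx /= orbF.
by apply: contraNneq yB => <-.
Qed.

Lemma matroid_delta M : is_matroid M -> is_delta_matroid M.
Proof.
move=> mM; have [M0 exM] := mM; split=> // X Y XM YM u.
rewrite in_symdiff; have [uX|uX] /= := boolP (u \in X) => uY.
  have [|y] := exM _ _ XM YM u; first by rewrite inE uX uY.
  rewrite inE => /andP[yX yY] M'.
  by exists y; rewrite ?symdiff_swap // in_symdiff (negPf yX).
pose P Z := [&& Z \in M, u \in Z & X :&: Y \subset Z].
have PY : P Y by rewrite /P YM uY subsetIr.
case: (arg_minnP (fun Z => #|Z :\: (u |: X)|) PY) => Z /and3P[ZM uZ XYZ] minZ.
have sZ : Z \subset u |: X.
  apply/subsetPn=> -[z zZ]; rewrite !inE negb_or => /andP[zu zX].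
  have [|y] := exM _ _ ZM XM z; first by rewrite inE zX zZ.
  rewrite inE => /andP[yZ yX] M'.
  have PZ' : P (y |: (Z :\ z)).
    rewrite /P M' !inE uZ (eq_sym u z) zu orbT /=.
    apply/subsetP=> t tXY; rewrite !inE (subsetP XYZ) // andbT.
    case: (eqVneq t z) tXY => [->|]; last by rewrite orbT.
    by rewrite inE (negPf zX).
  have := minZ _ PZ'; rewrite leqNgt => /negP; apply.
  apply: proper_card; apply/properP; split.
    by apply/subsetP=> t; rewrite !inE => /andP[tN] /orP[/eqP ty|/andP[_ ->]];
      rewrite ?tN //; rewrite ty yX orbT in tN.
  exists z; rewrite !inE ?negb_or ?zu ?zX ?zZ //= eqxx orbF.
  by apply: contraNneq zX => ->.
have cZ : #|Z| = #|X| by apply: matroid_card ZM XM.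
have /subsetPn[v vX vZ] : ~~ (X \subset Z).
  apply/negP=> sXZ; have /eqP XZ : X == Z by rewrite eqEcard sXZ cZ leqnn.
  by rewrite XZ uZ in uX.
have vY : v \notin Y by apply: contra vZ => vY; apply: (subsetP XYZ); rewrite inE vX.
exists v; first by rewrite in_symdiff vX (negPf vY).
rewrite setUC symdiff_swap //.
suff <- : Z = u |: (X :\ v) by [].
apply/eqP; rewrite eqEcard; apply/andP; split; last first.
  by rewrite cZ cardsU1 !inE (negPf uX) andbF (cardsD1 v X) vX.
apply/subsetP=> t tZ; move: (subsetP sZ _ tZ); rewrite !inE.
by case: eqP => //= _ ->; rewrite andbT; apply: contraNneq vZ => <-.
Qed.

Lemma twist_delta D A : is_delta_matroid D -> is_delta_matroid (twist D A).
Proof.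
move=> [/set0Pn[X0 X0D] exD]; split.
  by apply/set0Pn; exists (symdiff A X0); apply: imset_f.
move=> _ _ /imsetP[X XD ->] /imsetP[Y YD ->] u.
have eqXY w : (w \in symdiff (symdiff A X) (symdiff A Y)) = (w \in symdiff X Y).
  by rewrite !in_symdiff; do 3!case: (w \in _).
rewrite eqXY => /(exD _ _ XD YD)[v vXY XuvD]; exists v; rewrite ?eqXY //.
apply/imsetP; exists (symdiff X [set u; v]) => //.
by apply/setP=> w; rewrite !in_symdiff addbA.
Qed.

Lemma lower_matroid D : is_delta_matroid D -> is_matroid (lower D).
Proof.
move=> [/set0Pn[X0 X0D] exD]; split.
  case: (arg_minnP (fun X : {set E} => #|X|) X0D) => X XD minX.
  by apply/set0Pn; exists X; rewrite inE; apply/andP; split=> //; apply/forall_inP.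
move=> X Y; rewrite !inE => /andP[XD /forall_inP minX] /andP[YD _] x.
rewrite inE => /andP[xY xX].
have [|v] := exD _ _ XD YD x; first by rewrite in_symdiff xX (negPf xY).
rewrite in_symdiff => vXY D'.
have vX : v \notin X.
  apply/negP=> vX; have := minX _ D'; rewrite leqNgt => /negP; apply.
  apply: proper_card; apply/properP; split.
    apply/subsetP=> w; rewrite in_symdiff !inE.
    case: (eqVneq w x) => [->|_]; first by rewrite xX.
    by case: (eqVneq w v) => [->|_]; rewrite ?vX ?addbF.
  by exists x; rewrite // in_symdiff !inE xX eqxx.
exists v; first by rewrite inE vX; move: vXY; rewrite (negPf vX).
rewrite symdiff_swap // in D'; rewrite inE D'; apply/forall_inP=> Z ZD.
rewrite cardsU1 !inE (negPf vX) andbF.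
by have := minX _ ZD; rewrite (cardsD1 x X) xX.
Qed.

End SetSystems.

(* Main.v *)
Require Import Defs.
From mathcomp Require Import all_boot all_algebra.
From HB Require Import structures.
From mathcomp Require Import zify.

(** Minimizing #|symdiff A B| over the bases B of M amounts to maximizing
    #|A :&: B|, so the lower matroid of M*A is the direct sum of the dual of the
    restriction M|A and of the contraction M/A.  For binary M, represented by
    vectors v e over the field with two elements, this matroid is binary too,
    and its cycle space can be written down: Y is a cycle when
    - Y :&: A is the set of e in A with f (v e) = 1, for some linear functional
      f (a cocycle of M|A), and
    - the sum of v e over Y :\: A lies in the span of v on A (a cycle of M/A).
    This is [twist_cycle]; [dep_lower_twist] shows that a set is dependent
    exactly when it contains a nonempty cycle.  Cycles being closed under
    removal of a smaller cycle, each of them is a disjoint union of circuits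
    ([cycle_decomposition]).  Hence M*A bipartite makes all its cycles even,
    and a twist is Eulerian as soon as the whole ground set is a cycle.

    The dual of M*A is the twist of M by the complement of A ([dual_twist]), so
    it remains to see that the ground set is a cycle for ~: A
    ([twist_cycleT]).  Both halves come from linear duality.
    - For each functional f, the set of e in A with f (v e) = 1 is a cycle for
      A, hence even, so f kills the sum of v over A.  As f is arbitrary, this
      sum is 0, which is the contraction half.
    - A subset of ~: A on which v sums to 0 is a cycle for A, hence even.  So
      (0, 1) is not a sum of vectors (v e, 1) with e outside A, and a functional
      separating it from their span yields a functional that is 1 at each v e
      with e outside A, which is the other half. *)

Set Implicit Arguments.
Unset Strict Implicit.
Unset Printing Implicit Defensive.

Import GRing.Theory.
Local Open Scope ring_scope.

(** * Twists *)

Lemma dual_twist (E : finType) (D : set_system E) (A : {set E}) :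
  dual (twist D A) = twist D (~: A).
Proof.
rewrite /dual /twist -imset_comp; apply: eq_imset => X /=.
by apply/setP=> e; rewrite !in_symdiff !inE addbA.
Qed.

Lemma card_symdiff (E : finType) (A B : {set E}) :
  (#|symdiff A B| + (#|A :&: B| + #|A :&: B|) = #|A| + #|B|)%N.
Proof.
have dAB : [disjoint A :\: B & B :\: A].
  rewrite -setI_eq0; apply/eqP/setP=> e; rewrite !inE.
  by case: (e \in A); case: (e \in B).
have := cardsID B A; have := cardsID A B; rewrite (setIC B A) /symdiff.
move: dAB; rewrite -leq_card_setU => /eqP->; lia.
Qed.

Lemma leq_card_symdiff (E : finType) (A B B' : {set E}) : #|B| = #|B'| ->
  (#|symdiff A B| <= #|symdiff A B'|)%N = (#|A :&: B'| <= #|A :&: B|)%N.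
Proof. by have := card_symdiff A B; have := card_symdiff A B'; lia. Qed.

(** * Cycle spaces *)

Section CycleSpace.

Variables (E : finType) (N : set_system E) (Z : {set E} -> Prop).

Hypothesis dep_Z : forall X,
  ~~ indep N X <-> exists Y : {set E}, [/\ Y \subset X, Y != set0 & Z Y].
Hypothesis Z_diff : forall X Y, Z X -> Z Y -> Y \subset X -> Z (X :\: Y).

(** Z plays the part of the cycle space of a binary matroid: circuits are its
    minimal nonempty members, and they can be peeled off one at a time. *)
Lemma cycle_decomposition X : Z X ->
  exists P : {set {set E}},
    [/\ forall C, C \in P -> circuit N C, trivIset P & cover P = X].
Proof.
have [n] := ubnP #|X|; elim: n X => // n IH X ltXn ZX.
have [->|X0] := eqVneq X set0.
  exists set0; split=> [C|| ]; first by rewrite inE.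
    by apply/trivIsetP=> ? ?; rewrite inE.
  by rewrite /cover big_set0.
have depX : ~~ indep N X by apply/dep_Z; exists X.
have [C circC sCX] := minset_exists (P := fun Y : {set E} => ~~ indep N Y) depX.
have [Y [sYC Y0 ZY]] := (dep_Z C).1 (minsetp circC).
(* A circuit contains a nonempty cycle, which is dependent; minimality makes
   the two equal, so the circuit C is itself a cycle. *)
have YC : Y = C by apply: (minsetinf circC) => //; apply/dep_Z; exists Y.
subst Y.
have ltD : (#|X :\: C| < n)%N.
  rewrite -ltnS (leq_trans _ ltXn) // ltnS -(cardsID C X) (setIidPr sCX).
  by rewrite -[ltnLHS]add0n ltn_add2r card_gt0.
have [P [circP tP cP]] := IH _ ltD (Z_diff ZX ZY sCX).
have P0 : set0 \notin P.
  by apply/negP=> /circP/minsetp/dep_Z[Y []]; rewrite subset0 => ->.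
have dCP C' : C' \in P -> [disjoint C & C'].
  move=> C'P; have : C' \subset X :\: C by rewrite -cP; apply: bigcup_sup.
  by rewrite subsetD disjoint_sym => /andP[].
have [tCP CP] := trivIsetU1 dCP tP P0.
exists (C |: P); split=> //; first by move=> C' /setU1P[->|/circP].
by rewrite /cover big_setU1 //= -/(cover P) cP -[RHS](setID X C) (setIidPr sCX).
Qed.

End CycleSpace.

(** * Linear functionals *)

(** A nonzero coordinate of the component of x along a complement of U. *)
Lemma separating_functional (F : fieldType) (vT : vectType F)
    (U : {vspace vT}) (x : vT) : x \notin U ->
  exists f : {linear vT -> F^o}, (forall u, u \in U -> f u = 0) /\ f x != 0.
Proof.
move=> xU; pose y := x - projv U x.
have y0 : y != 0 by apply: contraNneq xU => /subr0_eq->; apply: memv_proj.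
have [i yi] : exists i, coord (vbasis fullv) i y != 0.
  apply/existsP; apply: contraNT y0 => /existsPn y0.
  rewrite [y](coord_vbasis (memvf y)) big1 // => i _.
  by move: (y0 i); rewrite negbK => /eqP->; rewrite scale0r.
exists (coord (vbasis fullv) i \o (\1 - projv U)%VF); split=> [u uU|] /=.
  by rewrite !lfunE /= !lfunE /= projv_id // subrr linear0.
by rewrite !lfunE /= !lfunE.
Qed.

(** The embedding of a factor in a product, as a linear map, so that functionals
    on the product can be restricted to the factor. *)
Definition pair_0r (R : pzRingType) (V W : lmodType R) (u : V) : V * W := (u, 0).

Fact pair_0r_linear (R : pzRingType) (V W : lmodType R) : linear (@pair_0r R V W).
Proof. by move=> a u u'; congr pair; rewrite /= scaler0 addr0. Qed.

HB.instance Definition _ (R : pzRingType) (V W : lmodType R) :=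
  GRing.isLinear.Build R V (V * W)%type _ (@pair_0r R V W) (@pair_0r_linear R V W).

(** * Vector families over the two-element field *)

Lemma F2_neq0 (k : 'F_2) : (k != 0) = (k == 1).
Proof. by case: k => -[|[|]]. Qed.

Lemma F2_bool (k : 'F_2) : k = (k != 0)%:R.
Proof. by apply/eqP; case: k => -[|[|]]. Qed.

Lemma F2_natr (n : nat) : n%:R = (odd n)%:R :> 'F_2.
Proof.
rewrite -[in LHS](odd_double_half n) natrD -mul2n natrM.
by rewrite (_ : 2%:R = 0 :> 'F_2) ?mul0r ?addr0 //; apply/eqP.
Qed.

Section Family.

Variables (E : finType) (vT : vectType 'F_2) (v : E -> vT).
Implicit Types (X Y B : {set E}) (e : E).

Definition vsum X : vT := \sum_(e in X) v e.

Definition vspan X : {vspace vT} := (\sum_(e in X) <[v e]>)%VS.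

Definition vfree X : bool := free [seq v e | e <- enum X].

Lemma addvv (x : vT) : x + x = 0.
Proof.
rewrite -[x]scale1r -scalerDl (_ : 1 + 1 = 0 :> 'F_2) ?scale0r //.
exact/eqP.
Qed.

Lemma vsumD X Y : Y \subset X -> vsum (X :\: Y) = vsum X - vsum Y.
Proof.
move=> sYX; rewrite /vsum (big_setID Y (A := X)) /= (setIidPr sYX).
by rewrite addrC addrK.
Qed.

Lemma vspan_seq X : <<[seq v e | e <- enum X]>>%VS = vspan X.
Proof. by rewrite span_def big_map big_enum. Qed.

Lemma mem_vspan X e : e \in X -> v e \in vspan X.
Proof.
by move=> eX; rewrite -vspan_seq memv_span // map_f // mem_enum.
Qed.

(** The only coefficients are 0 and 1, so linear combinations are subset sums. *)
Lemma vspanP X (x : vT) :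
  reflect (exists2 Y : {set E}, Y \subset X & x = vsum Y) (x \in vspan X).
Proof.
apply: (iffP idP) => [/memv_sumP[w wv ->]|[Y sYX ->]]; last first.
  by apply: memv_suml => e /(subsetP sYX); apply: mem_vspan.
exists [set e in X | w e != 0]; first by apply/subsetP=> e; rewrite inE => /andP[].
rewrite [LHS](bigID (fun e => w e != 0)) /= [X in _ + X]big1 ?addr0; last first.
  by move=> e /andP[_]; rewrite negbK => /eqP.
apply: eq_big => [e|e /andP[eX]]; first by rewrite inE.
have /vlineP[k ->] := wv e eX; rewrite scaler_eq0 negb_or => /andP[k0 _].
by move: k0; rewrite F2_neq0 => /eqP->; rewrite scale1r.
Qed.

Lemma vspan_subv X (U : {vspace vT}) :
  (forall e, e \in X -> v e \in U) -> (vspan X <= U)%VS.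
Proof.
by move=> XU; apply/subv_sumP => e eX; rewrite -memvE XU.
Qed.

Lemma vspanS X Y : X \subset Y -> (vspan X <= vspan Y)%VS.
Proof.
by move=> sXY; apply: vspan_subv => e /(subsetP sXY); apply: mem_vspan.
Qed.

Lemma vfreeU1 X e : e \notin X ->
  vfree (e |: X) = (v e \notin vspan X) && vfree X.
Proof.
move=> eX; rewrite -vspan_seq /vfree -free_cons -map_cons.
apply/perm_free/perm_map/uniq_perm; rewrite /= ?enum_uniq ?mem_enum ?eX //.
by move=> e'; rewrite in_cons !mem_enum in_setU1.
Qed.

Lemma vfreeS X Y : X \subset Y -> vfree Y -> vfree X.
Proof.
move=> sXY; have [n] := ubnP #|Y :\: X|; elim: n Y sXY => // n IH Y sXY ltn fY.
have [sYX|/subsetPn[e eY eX]] := boolP (Y \subset X).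
  by have -> : X = Y by apply/eqP; rewrite eqEsubset sXY.
apply: (IH (Y :\ e)).
- by rewrite subsetD1 sXY.
- rewrite setDDl setUC -setDDl.
  by move: ltn; rewrite (cardsD1 e (_ :\: _)) inE eX eY.
- by move: fY; rewrite -{1}(setD1K eY) vfreeU1 ?setD11 // => /andP[].
Qed.

Lemma vfree_span_card X Y : vfree X -> (vspan X <= vspan Y)%VS -> (#|X| <= #|Y|)%N.
Proof.
rewrite /vfree /free vspan_seq size_map -cardE => /eqP<- /dimvS le.
by apply: leq_trans le _; rewrite -vspan_seq (leq_trans (dim_span _)) ?size_map ?cardE.
Qed.

Lemma vbasis_exists X : exists B : {set E}, [/\ B \subset X, vfree B & vspan B = vspan X].
Proof.
have f0 : (set0 \subset X) && vfree set0.
  by rewrite sub0set /vfree enum_set0 /= nil_free.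
have [B /maxsetP[/andP[sBX fB] maxB] _] :=
  maxset_exists (P := fun B : {set E} => (B \subset X) && vfree B) f0.
exists B; split=> //; apply/eqP; rewrite eqEsubv vspanS //=.
apply: vspan_subv => e eX; have [eB|eB] := boolP (e \in B); first exact: mem_vspan.
apply: contraNT (eB) => veB; rewrite -(maxB (e |: B)) ?setU11 ?subsetUr //.
by rewrite vfreeU1 // veB fB subUset sub1set eX sBX.
Qed.

(** Over two elements a linear dependency is a nonempty subset of sum zero; this
    describes the cycle space of the matroid of the family. *)
Lemma vfreeP X :
  reflect (forall Y, Y \subset X -> vsum Y = 0 -> Y = set0) (vfree X).
Proof.
apply: (iffP idP) => [fX Y sYX Y0 | X0].
  have [//|/set0Pn[e eY]] := eqVneq Y set0.
  have := vfreeS sYX fX; rewrite -(setD1K eY) vfreeU1 ?setD11 //.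
  case/andP=> /negP[]; apply/vspanP; exists (Y :\ e) => //.
  rewrite vsumD ?sub1set // Y0 sub0r /vsum big_set1.
  by apply/eqP; rewrite -subr_eq0 opprK addvv.
have [B [sBX fB spB]] := vbasis_exists X.
suff -> : X = B by [].
apply/eqP; rewrite eqEsubset sBX andbT; apply/subsetP=> e eX.
apply: contraT => eB; have := mem_vspan eX; rewrite -spB => /vspanP[Y sYB ve].
have eY : e \notin Y by apply: contra eB => /(subsetP sYB).
have: e |: Y = set0.
  apply: X0; first by rewrite subUset sub1set eX (subset_trans sYB).
  by rewrite /vsum big_setU1 //= -/(vsum Y) -ve addvv.
by move/setP/(_ e); rewrite !inE eqxx.
Qed.

End Family.

(** * The lower matroid of a twist *)

Section TwistedMatroid.

Variables (E : finType) (M : set_system E) (vT : vectType 'F_2) (v : E -> vT).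

Hypothesis mM : is_matroid M.
Hypothesis repM : forall X, indep M X = vfree v X.

Implicit Types (A B X Y C : {set E}).

(** The cycle space of the lower matroid of M*A, that is of the direct sum of
    the dual of M|A and of M/A.  The first half says that Y :&: A is a cocycle
    of M|A; the second one that Y :\: A can be completed by elements of A to a
    set of sum zero, hence is a cycle of M/A. *)
Definition twist_cycle A Y : Prop :=
  (exists f : {linear vT -> ('F_2)^o}, forall e, e \in A -> f (v e) = (e \in Y)%:R)
  /\ vsum v (Y :\: A) \in vspan v A.

Lemma basis_vfree B X : B \in M -> X \subset B -> vfree v X.
Proof. by move=> BM sXB; rewrite -repM; apply/exists_inP; exists B. Qed.

(** If A :&: B does not span A, an element of A outside its span extends it to an
    independent set, and then to a basis that meets A in more elements. *)
Lemma max_inter_basisP A B : B \in M ->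
  reflect (forall B', B' \in M -> #|A :&: B'| <= #|A :&: B|)%N
          (vspan v (A :&: B) == vspan v A).
Proof.
move=> BM; apply: (iffP eqP) => [spB B' B'M | maxB].
  apply: (@vfree_span_card _ _ v); first exact: basis_vfree B'M (subsetIr _ _).
  by rewrite spB vspanS // subsetIl.
apply/eqP; rewrite eqEsubv vspanS ?subsetIl //=; apply: vspan_subv => e eA.
apply: contraT => veB.
have eB : e \notin A :&: B by apply: contra veB; apply: mem_vspan.
have : vfree v (e |: (A :&: B)).
  by rewrite vfreeU1 // veB (basis_vfree BM (subsetIr _ _)).
rewrite -repM => /exists_inP[B' B'M sB'].
have := maxB _ B'M; rewrite leqNgt => /negP[].
rewrite -add1n -[1%N](congr1 nat_of_bool eB) -cardsU1; apply: subset_leq_card.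
by rewrite subsetI sB' subUset sub1set eA subsetIl.
Qed.

Lemma indep_lower_twistP A X :
  reflect (exists B : {set E}, [/\ B \in M, X \subset symdiff A B
                       & vspan v (A :&: B) = vspan v A])
          (indep (lower (twist M A)) X).
Proof.
apply: (iffP exists_inP) => [[_ /[!inE]/andP[/imsetP[B BM ->] minB] sXB]|].
  exists B; split=> //; apply/eqP/max_inter_basisP => // B' B'M.
  rewrite -leq_card_symdiff; last exact: matroid_card mM BM B'M.
  by apply: (forall_inP minB); apply: imset_f.
case=> B [BM sXB /eqP/(max_inter_basisP _ BM) maxB]; exists (symdiff A B) => //.
rewrite inE imset_f //=; apply/forall_inP=> _ /imsetP[B' B'M ->].
by rewrite leq_card_symdiff ?maxB //; apply: matroid_card mM BM B'M.
Qed.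

(** Let X contain no nonempty cycle.  Then A :\: X spans A, as otherwise a
    functional separating an element of A from its span cuts out a cocycle
    inside X.  Take a basis B of A :\: X.  Then B and X :\: A are jointly
    independent, as a dependency would leave a cycle of M/A inside X; a basis of
    M extending them meets A exactly in B, and witnesses that X is
    independent. *)
Lemma dep_lower_twist A X :
  ~~ indep (lower (twist M A)) X <->
  exists Y : {set E}, [/\ Y \subset X, Y != set0 & twist_cycle A Y].
Proof.
split=> [dX | [Y [sYX Y0 [[f fY] spY]]]]; last first.
  apply: contra Y0 => /indep_lower_twistP[B [BM sXB spB]].
  have sYB := subset_trans sYX sXB.
  (* f vanishes on A :&: B, which spans A, so f is 0 on A and Y misses A. *)
  have YA e : e \in A -> e \notin Y.
    move=> eA; suff /eqP : f (v e) = 0 by rewrite fY //; case: (e \in Y).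
    have := mem_vspan v eA; rewrite -spB => /vspanP[S sSAB ->].
    rewrite /vsum linear_sum big1 // => e' /(subsetP sSAB) /[!inE] /andP[e'A e'B].
    rewrite fY //; case: (boolP (e' \in Y)) => // /(subsetP sYB).
    by rewrite in_symdiff e'A e'B.
  have YDA : Y :\: A = Y.
    apply/setP=> e; rewrite inE; case: (boolP (e \in A)) => //= /YA/negPf->//.
  move: spY; rewrite YDA -spB => /vspanP[S sSAB sYS].
  have YS : [disjoint Y & S].
    rewrite -setI_eq0; apply/eqP/setP=> e; rewrite !inE; apply/negP=> /andP[eY].
    by move/(subsetP sSAB); rewrite inE => /andP[/YA]; rewrite eY.
  suff /eqP : Y :|: S = set0 by rewrite setU_eq0 => /andP[].
  apply: (vfreeP v B (basis_vfree BM (subxx _))).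
    apply/subsetP=> e; rewrite inE => /orP[eY|/(subsetP sSAB)].
      move: (subsetP sYB _ eY); rewrite in_symdiff.
      by case: (boolP (e \in A)) => [/YA|_ //]; rewrite eY.
    by rewrite inE => /andP[].
  rewrite /vsum (eq_bigl [predU Y & S] _ (fun e => in_setU e Y S)) bigU //=.
  by rewrite -/(vsum v Y) -/(vsum v S) sYS addvv.
have sAXA : (vspan v (A :\: X) <= vspan v A)%VS by rewrite vspanS ?subsetDl.
(* Either a cocycle of M|A lies in X, or A :\: X spans A. *)
have [|spanA] := boolP [exists e in A, v e \notin vspan v (A :\: X)].
  case/exists_inP=> e eA /separating_functional[f [f0 fe]].
  exists [set e in A | f (v e) != 0]; split.
  - apply/subsetP=> e' /[!inE] /andP[e'A]; apply: contraR => e'X.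
    by rewrite f0 // mem_vspan // inE e'X.
  - by apply/set0Pn; exists e; rewrite inE eA.
  split; first by exists f => e' e'A; rewrite inE e'A -F2_bool.
  rewrite (_ : _ :\: A = set0) ?/vsum ?big_set0 ?mem0v //.
  by apply/setP=> e'; rewrite !inE; case: (e' \in A).
have [B [sBAX fB spB]] := vbasis_exists v (A :\: X).
have spBA : vspan v B = vspan v A.
  apply/eqP; rewrite spB eqEsubv sAXA vspan_subv // => e eA.
  by apply: contraNT spanA => ve; apply/exists_inP; exists e.
have /subsetDP[sBA dBX] := sBAX.
(* Either B and X :\: A are jointly independent, or a dependency S between
   them gives the cycle S :\: A. *)
have [fBX|] := boolP (vfree v (B :|: (X :\: A))).
  case/negP: dX; apply/indep_lower_twistP.
  move: fBX; rewrite -repM => /exists_inP[B' B'M sB'].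
  have spB' : vspan v (A :&: B') = vspan v A.
    apply/eqP; rewrite eqEsubv vspanS ?subsetIl // -{1}spBA vspanS //.
    by rewrite subsetI sBA (subset_trans (subsetUl _ _) sB').
  exists B'; split=> //; apply/subsetP=> e eX; rewrite in_symdiff.
  have [eA|eA] := boolP (e \in A); last first.
    by rewrite (subsetP sB') // !inE eX eA orbT.
  (* B' misses X :&: A, since B already spans A. *)
  have eB : e \notin B by apply/negP=> /(subsetP sBAX); rewrite inE eX.
  apply/negP=> eB'; have: vfree v (e |: B).
    apply: basis_vfree B'M _; rewrite subUset sub1set eB'.
    exact: subset_trans (subsetUl _ _) sB'.
  by rewrite vfreeU1 // spBA mem_vspan.
move=> nfree; have /existsP[S /and3P[sS /eqP S0 Sn0]] :
    [exists S : {set E}, [&& S \subset B :|: (X :\: A), vsum v S == 0 & S != set0]].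
  apply: contraNT nfree => /existsPn noS; apply/vfreeP => S sS S0.
  by apply/eqP; have := noS S; rewrite sS S0 eqxx negbK.
exists (S :\: A); split.
- apply/subsetP=> e /setDP[/(subsetP sS)]; rewrite !inE => /orP[/(subsetP sBA)->//|].
  by case/andP.
- apply: contra Sn0; rewrite setD_eq0 => sSA; apply/eqP.
  apply: (vfreeP v B fB) => //; apply/subsetP=> e eS.
  by move: (subsetP sS e eS); rewrite !inE (subsetP sSA) // orbF.
split; first by exists \0%R => e eA; rewrite inE eA.
rewrite setDDl setUid -(set0U (S :\: A)) -(setDv S) -setDIr vsumD ?subsetIl //.
by rewrite S0 sub0r memvN; apply/vspanP; exists (S :&: A); rewrite ?subsetIr.
Qed.

Lemma twist_cycleD A X Y : twist_cycle A X -> twist_cycle A Y -> Y \subset X ->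
  twist_cycle A (X :\: Y).
Proof.
move=> [[f fX] spX] [[g gY] spY] sYX; split.
  exists (f \- g) => e eA /=; rewrite fX // gY // inE.
  case: (boolP (e \in Y)) => [/(subsetP sYX)->|_]; first by rewrite subrr.
  by rewrite subr0.
have -> : (X :\: Y) :\: A = (X :\: A) :\: (Y :\: A).
  by apply/setP=> e; rewrite !inE; case: (e \in A); rewrite /= ?andbF ?andbT.
by rewrite vsumD ?memvB // setSD.
Qed.

Lemma even_twist_cycle A Y :
  bipartite (twist M A) -> twist_cycle A Y -> ~~ odd #|Y|.
Proof.
move=> bip /(cycle_decomposition (@dep_lower_twist A) (@twist_cycleD A)).
case=> P [circP /eqP tP <-]; rewrite -tP.
apply: (big_ind (fun n => ~~ odd n)) => // [m n | C /circP]; last exact: bip.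
by rewrite oddD => /negPf-> /negPf->.
Qed.

Lemma eulerian_twist A : twist_cycle A [set: E] -> eulerian (twist M A).
Proof. exact: cycle_decomposition (@dep_lower_twist A) (@twist_cycleD A) _. Qed.

Lemma twist_cycleT A :
  bipartite (twist M A) -> twist_cycle (~: A) [set: E].
Proof.
move=> bip; split; last first.
  rewrite setTD setCK (_ : vsum v A = 0) ?mem0v //.
  apply/eqP; apply: contraT => nz.
  have [f [_ fA]] : exists f : {linear vT -> ('F_2)^o},
      (forall u, u \in 0%VS -> f u = 0) /\ f (vsum v A) != 0.
    by apply: separating_functional; rewrite memv0.
  pose Y := [set e in A | f (v e) != 0].
  have : ~~ odd #|Y|.
    apply: even_twist_cycle bip _; split.
      by exists f => e eA; rewrite inE eA -F2_bool.
    rewrite (_ : Y :\: A = set0) ?/vsum ?big_set0 ?mem0v //.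
    by apply/setP=> e; rewrite !inE; case: (e \in A).
  move: fA; rewrite /vsum linear_sum.
  have -> : \sum_(e in A) f (v e) = #|Y|%:R.
    rewrite -sumr_const [LHS](bigID (fun e => f (v e) == 0)) /= big1 ?add0r.
      by apply: eq_big => [e|e /andP[_]]; rewrite ?inE // F2_neq0 => /eqP.
    by move=> e /andP[_ /eqP].
  by rewrite F2_natr; case: (odd _).
(* Sums of the vectors (v e, 1) keep track of the parity of the number of
   terms. *)
pose w e : vT * ('F_2)^o := (v e, 1).
have vsum_w Y : vsum w Y = (vsum v Y, #|Y|%:R).
  rewrite /vsum -sumr_const; apply: (big_ind3 (fun x y z => x = (y, z))) => //.
  by move=> ? y z ? y' z' -> ->.
have [|f [f0 f1]] := @separating_functional _ _ (vspan w (~: A)) (0, 1).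
  apply/negP=> /vspanP[Y sYA]; rewrite vsum_w => -[Y0 cY].
  have YA : Y :\: A = Y by apply/setDidPl; rewrite disjoints_subset.
  suff : ~~ odd #|Y| by move: cY; rewrite F2_natr; case: (odd _).
  apply: even_twist_cycle bip _; split; last by rewrite YA -Y0 mem0v.
  exists \0%R => e eA /=; have := subsetP sYA e; rewrite inE eA.
  by case: (e \in Y) => // /(_ isT).
exists (f \o @pair_0r _ _ _) => e eA; rewrite inE /=.
move: f1; rewrite F2_neq0 => /eqP f1.
(* f is 0 at w e and 1 at (0, 1), hence -1 = 1 at their difference (v e, 0). *)
have -> : pair_0r ('F_2)^o (v e) = w e - (0, 1).
  by congr pair; rewrite /= ?subr0 ?subrr.
by rewrite linearB f0 ?mem_vspan // f1; apply/eqP.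
Qed.

End TwistedMatroid.

(** * Duality *)

Theorem theorem13 (E : finType) (M : set_system E) (A : {set E}) :
  is_binary_matroid M ->
  bipartite (twist M A) -> eulerian (dual (twist M A)).
Proof.
move=> [mM [m [v repM]]] bip; rewrite dual_twist.
by apply: (eulerian_twist mM repM); apply: twist_cycleT bip.
Qed.
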